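(* Let $I,J\subset\mathbb{R}$ be open intervals, $t_0\in J$, and let $r:I\to\mathbb{R}^3$ be a smooth arclength parametrized curve with $r''(s)\neq 0$ for all $s\in I$, with Frenet frame $\{T,N,B\}$, curvature $\kappa$ and torsion $\tau$. Let $x:I\times J\to\mathbb{R}^3$ be a smooth regular parametrized surface. Then $x$ is an isothermally parametrized minimal surface passing through $r$ in the sense that $x(s,t_0)=r(s)$ for all $s\in I$ if and only if there exist smooth functions $u,v,w:I\times J\to\mathbb{R}$ such that $$x(s,t)=r(s)+u(s,t)T(s)+v(s,t)N(s)+w(s,t)B(s)\quad\text{for all }(s,t)\in I\times J,$$ $$u(s,t_0)=v(s,t_0)=w(s,t_0)=0\quad\text{for all }s\in I,$$ and the following equations hold on $I\times J$: $$(1+u_s-\kappa v)^2+(v_s+\kappa u-\tau w)^2+(w_s+\tau v)^2=u_t^2+v_t^2+w_t^2,$$ $$(1+u_s-\kappa v)u_t+(v_s+\kappa u-\tau w)v_t+(w_s+\tau v)w_t=0,$$ $$(1+u_s-\kappa v)_s-\kappa(v_s+\kappa u-\tau w)+u_{tt}=0,$$ $$(v_s+\kappa u-\tau w)_s+\kappa(1+u_s-\kappa v)-\tau(w_s+\tau v)+v_{tt}=0,$$ $$(w_s+\tau v)_s+\tau(v_s+\kappa u-\tau w)+w_{tt}=0.$$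
   Context: Subscripts $s,t$ denote partial derivatives. The Frenet frame of the arclength parametrized curve $r$ is $T=r'$, $N=T'/\|T'\|$, $B=T\times N$; curvature $\kappa$ and torsion $\tau$ are determined by $T'=\kappa N$, $N'=-\kappa T+\tau B$, $B'=-\tau N$. A regular parametrized surface $x(s,t)$ is isothermal (isothermally parametrized) if $\langle x_s,x_s\rangle=\langle x_t,x_t\rangle$ and $\langle x_s,x_t\rangle=0$. A surface is minimal if its mean curvature vanishes everywhere. *)

(* Defs.v *)
From Stdlib Require Import Reals Lra Nsatz.
From Coquelicot Require Import Coquelicot.

Open Scope R_scope.

(* Vector addition and scaling on R3 are Coquelicot's [plus], [scal] and [zero]
   for product modules. *)
Notation R3 := (R * R * R)%type.

Definition crd1 (a : R3) : R := fst (fst a).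
Definition crd2 (a : R3) : R := snd (fst a).
Definition crd3 (a : R3) : R := snd a.

Definition dot (a b : R3) : R :=
  crd1 a * crd1 b + crd2 a * crd2 b + crd3 a * crd3 b.

Definition cross (a b : R3) : R3 :=
  (crd2 a * crd3 b - crd3 a * crd2 b,
   crd3 a * crd1 b - crd1 a * crd3 b,
   crd1 a * crd2 b - crd2 a * crd1 b).

Definition vnorm (a : R3) : R := sqrt (dot a a).

(* Functions on an interval I, or on a rectangle I x J, are represented by total
   functions whose values elsewhere are irrelevant: since the domains are open,
   all the derivatives below depend, at points of the domain, only on the values
   taken there. *)
Definition is_open_interval (I : R -> Prop) : Prop :=
  exists a b : Rbar,
    Rbar_lt a b /\ forall s : R, I s <-> Rbar_lt a s /\ Rbar_lt s b.

Definition ds (f : R -> R -> R) (s t : R) : R := Derive (fun s' => f s' t) s.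
Definition dt (f : R -> R -> R) (s t : R) : R := Derive (fun t' => f s t') t.

Definition vDerive (f : R -> R3) (s : R) : R3 :=
  (Derive (fun s' => crd1 (f s')) s,
   Derive (fun s' => crd2 (f s')) s,
   Derive (fun s' => crd3 (f s')) s).

Definition vds (x : R -> R -> R3) (s t : R) : R3 := vDerive (fun s' => x s' t) s.
Definition vdt (x : R -> R -> R3) (s t : R) : R3 := vDerive (fun t' => x s t') t.

Definition smooth_on (I : R -> Prop) (f : R -> R) : Prop :=
  forall (n : nat) (s : R), I s -> ex_derive_n f n s.

(* [ex_diff_n f n s t]: all iterated partial derivatives of f of order at most n,
   in any order of differentiation, exist and are continuous at (s, t). *)
Definition smooth2_on (I J : R -> Prop) (f : R -> R -> R) : Prop :=
  forall (n : nat) (s t : R), I s -> J t -> ex_diff_n f n s t.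

Definition smooth_curve (I : R -> Prop) (r : R -> R3) : Prop :=
  smooth_on I (fun s => crd1 (r s)) /\
  smooth_on I (fun s => crd2 (r s)) /\
  smooth_on I (fun s => crd3 (r s)).

Definition smooth_surface (I J : R -> Prop) (x : R -> R -> R3) : Prop :=
  smooth2_on I J (fun s t => crd1 (x s t)) /\
  smooth2_on I J (fun s t => crd2 (x s t)) /\
  smooth2_on I J (fun s t => crd3 (x s t)).

Definition arclength_param (I : R -> Prop) (r : R -> R3) : Prop :=
  forall s : R, I s -> vnorm (vDerive r s) = 1.

Definition frenetT (r : R -> R3) (s : R) : R3 := vDerive r s.
Definition frenetN (r : R -> R3) (s : R) : R3 :=
  scal (/ vnorm (vDerive (frenetT r) s)) (vDerive (frenetT r) s).
Definition frenetB (r : R -> R3) (s : R) : R3 := cross (frenetT r s) (frenetN r s).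

(* [frenet_serret] below shows that these are the unique coefficients in the
   Frenet equations. *)
Definition curvature (r : R -> R3) (s : R) : R := vnorm (vDerive (frenetT r) s).
Definition torsion (r : R -> R3) (s : R) : R :=
  dot (vDerive (frenetN r) s) (frenetB r s).

Definition regular (I J : R -> Prop) (x : R -> R -> R3) : Prop :=
  forall s t : R, I s -> J t -> cross (vds x s t) (vdt x s t) <> zero.

Definition isothermal (I J : R -> Prop) (x : R -> R -> R3) : Prop :=
  forall s t : R, I s -> J t ->
    dot (vds x s t) (vds x s t) = dot (vdt x s t) (vdt x s t) /\
    dot (vds x s t) (vdt x s t) = 0.

Definition unit_normal (x : R -> R -> R3) (s t : R) : R3 :=
  scal (/ vnorm (cross (vds x s t) (vdt x s t))) (cross (vds x s t) (vdt x s t)).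

(* Half the trace of the shape operator, whose matrix in the basis (x_s, x_t) is
   the inverse of the first fundamental form (E, F, G) times the second (e, f, g). *)
Definition mean_curvature (x : R -> R -> R3) (s t : R) : R :=
  let E := dot (vds x s t) (vds x s t) in
  let F := dot (vds x s t) (vdt x s t) in
  let G := dot (vdt x s t) (vdt x s t) in
  let e := dot (vds (vds x) s t) (unit_normal x s t) in
  let f := dot (vds (vdt x) s t) (unit_normal x s t) in
  let g := dot (vdt (vdt x) s t) (unit_normal x s t) in
  (e * G - 2 * f * F + g * E) / (2 * (E * G - F ^ 2)).

Definition minimal (I J : R -> Prop) (x : R -> R -> R3) : Prop :=
  forall s t : R, I s -> J t -> mean_curvature x s t = 0.

Lemma is_open_interval_locally (I : R -> Prop) (s : R) :
  is_open_interval I -> I s -> locally s I.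
Proof.
intros [a [b [_ HI]]] Hs.
apply HI in Hs. destruct Hs as [Ha Hb].
apply (filter_imp (fun y : R => Rbar_lt a y /\ Rbar_lt y b)).
- intros y Hy. now apply HI.
- apply filter_and; [now apply open_Rbar_gt | now apply open_Rbar_lt].
Qed.

Definition ex_vderive (f : R -> R3) (s : R) : Prop :=
  ex_derive (fun y => crd1 (f y)) s /\
  ex_derive (fun y => crd2 (f y)) s /\
  ex_derive (fun y => crd3 (f y)) s.

Lemma ex_derive_dot (f g : R -> R3) (s : R) :
  ex_vderive f s -> ex_vderive g s -> ex_derive (fun y => dot (f y) (g y)) s.
Proof.
intros [F1 [F2 F3]] [G1 [G2 G3]].
unfold dot.
apply (ex_derive_plus (V := R_NormedModule)); [apply (ex_derive_plus (V := R_NormedModule)) |];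
  now apply ex_derive_mult.
Qed.

Lemma Derive_dot (f g : R -> R3) (s : R) :
  ex_vderive f s -> ex_vderive g s ->
  Derive (fun y => dot (f y) (g y)) s
  = dot (vDerive f s) (g s) + dot (f s) (vDerive g s).
Proof.
intros [F1 [F2 F3]] [G1 [G2 G3]].
unfold dot.
assert (P1 := ex_derive_mult _ _ s F1 G1).
assert (P2 := ex_derive_mult _ _ s F2 G2).
assert (P3 := ex_derive_mult _ _ s F3 G3).
assert (P12 := ex_derive_plus (V := R_NormedModule) _ _ s P1 P2).
rewrite Derive_plus, Derive_plus, 3!Derive_mult by assumption.
unfold vDerive, crd1, crd2, crd3; simpl; ring.
Qed.

Lemma vDerive_cross (f g : R -> R3) (s : R) :
  ex_vderive f s -> ex_vderive g s ->
  vDerive (fun y => cross (f y) (g y)) s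
  = plus (cross (vDerive f s) (g s)) (cross (f s) (vDerive g s)).
Proof.
intros [F1 [F2 F3]] [G1 [G2 G3]].
change (vDerive (fun y => cross (f y) (g y)) s) with
  (Derive (fun y => crd2 (f y) * crd3 (g y) - crd3 (f y) * crd2 (g y)) s,
   Derive (fun y => crd3 (f y) * crd1 (g y) - crd1 (f y) * crd3 (g y)) s,
   Derive (fun y => crd1 (f y) * crd2 (g y) - crd2 (f y) * crd1 (g y)) s).
apply (f_equal2 pair); [apply (f_equal2 pair) |];
  rewrite Derive_minus, 2!Derive_mult by auto using ex_derive_mult;
  unfold vDerive, cross, crd1, crd2, crd3; simpl; unfold plus; simpl; ring.
Qed.

Lemma plus_R3 (a1 a2 a3 b1 b2 b3 : R) :
  plus ((a1, a2, a3) : R3) (b1, b2, b3) = (a1 + b1, a2 + b2, a3 + b3).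
Proof. reflexivity. Qed.

Lemma scal_R3 (k a1 a2 a3 : R) :
  scal k ((a1, a2, a3) : R3) = (k * a1, k * a2, k * a3).
Proof. reflexivity. Qed.

Lemma dot_comm (a b : R3) : dot a b = dot b a.
Proof. unfold dot; ring. Qed.

Lemma dot_scal_l (k : R) (a b : R3) : dot (scal k a) b = k * dot a b.
Proof.
destruct a as [[a1 a2] a3]; rewrite scal_R3.
unfold dot, crd1, crd2, crd3; simpl; ring.
Qed.

Lemma dot_scal_r (k : R) (a b : R3) : dot a (scal k b) = k * dot a b.
Proof. now rewrite dot_comm, dot_scal_l, dot_comm. Qed.

Lemma dot_pos (a : R3) : a <> zero -> 0 < dot a a.
Proof.
destruct a as [[a1 a2] a3]; intros Ha; unfold dot, crd1, crd2, crd3; simpl.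
assert (H : ~ (a1 = 0 /\ a2 = 0 /\ a3 = 0)) by
  (intros [-> [-> ->]]; now apply Ha).
destruct (Req_dec a1 0); [| nra].
destruct (Req_dec a2 0); [| nra].
destruct (Req_dec a3 0); [tauto | nra].
Qed.

Lemma frenet_regularity (I : R -> Prop) (r : R -> R3) (s : R) :
  smooth_curve I r -> I s -> vDerive (vDerive r) s <> zero ->
  ex_vderive (frenetT r) s /\ ex_vderive (frenetN r) s.
Proof.
intros [H1 [H2 H3]] Hs Hr.
split.
- split; [exact (H1 2%nat s Hs) | split; [exact (H2 2%nat s Hs) | exact (H3 2%nat s Hs)]].
- assert (D1 := H1 3%nat s Hs). assert (D2 := H2 3%nat s Hs).
  assert (D3 := H3 3%nat s Hs).
  assert (P := dot_pos _ Hr).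
  change (ex_derive (fun y => crd1 (vDerive (vDerive r) y)) s) in D1.
  change (ex_derive (fun y => crd2 (vDerive (vDerive r) y)) s) in D2.
  change (ex_derive (fun y => crd3 (vDerive (vDerive r) y)) s) in D3.
  unfold ex_vderive, frenetN, frenetT, vnorm.
  set (p := vDerive (vDerive r)) in *.
  assert (S : ex_derive (fun y => / sqrt (dot (p y) (p y))) s).
  { apply (ex_derive_comp (fun z : R => / sqrt z) (fun y => dot (p y) (p y))).
    - auto_derive; repeat split; [exact P | now apply Rgt_not_eq, sqrt_lt_R0].
    - now apply ex_derive_dot. }
  split; [| split].
  + now apply (ex_derive_mult (fun y => / sqrt (dot (p y) (p y))) (fun y => crd1 (p y))).
  + now apply (ex_derive_mult (fun y => / sqrt (dot (p y) (p y))) (fun y => crd2 (p y))).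
  + now apply (ex_derive_mult (fun y => / sqrt (dot (p y) (p y))) (fun y => crd3 (p y))).
Qed.

Lemma Derive_locally_const (I : R -> Prop) (f : R -> R) (c s : R) :
  is_open_interval I -> I s -> (forall y, I y -> f y = c) -> Derive f s = 0.
Proof.
intros HI Hs Hf.
rewrite <- (Derive_const c s).
apply Derive_ext_loc.
apply (filter_imp I); [exact Hf | now apply is_open_interval_locally].
Qed.

Lemma frenetTT (I : R -> Prop) (r : R -> R3) (s : R) :
  arclength_param I r -> I s -> dot (frenetT r s) (frenetT r s) = 1.
Proof.
intros Hr Hs. specialize (Hr s Hs). unfold vnorm in Hr.
rewrite <- (Rsqr_sqrt (dot (frenetT r s) (frenetT r s))).
- unfold frenetT; rewrite Hr; unfold Rsqr; ring.
- unfold dot; nra.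
Qed.

Lemma curvature_spec (r : R -> R3) (s : R) :
  vDerive (vDerive r) s <> zero ->
  0 < curvature r s /\ vDerive (frenetT r) s = scal (curvature r s) (frenetN r s).
Proof.
intros Hr.
assert (P : 0 < curvature r s) by now apply sqrt_lt_R0, dot_pos.
split; [exact P |].
unfold frenetN; fold (curvature r s).
rewrite scal_assoc.
replace (mult (curvature r s) (/ curvature r s)) with (@one R_Ring);
  [now rewrite scal_one |].
unfold mult, one; simpl; field; lra.
Qed.

Lemma frenetNN (r : R -> R3) (s : R) :
  vDerive (vDerive r) s <> zero -> dot (frenetN r s) (frenetN r s) = 1.
Proof.
intros Hr.
assert (P := dot_pos _ Hr).
assert (Q := sqrt_lt_R0 _ P).
assert (S := sqrt_sqrt _ (Rlt_le _ _ P)).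
unfold frenetN, frenetT, vnorm.
set (p := vDerive (vDerive r) s) in *.
set (k := sqrt (dot p p)) in *.
transitivity (/ k * / k * dot p p).
- rewrite dot_scal_l, dot_scal_r; ring.
- rewrite <- S; field; lra.
Qed.

Lemma frenetTN (I : R -> Prop) (r : R -> R3) (s : R) :
  is_open_interval I -> smooth_curve I r -> arclength_param I r -> I s ->
  vDerive (vDerive r) s <> zero -> dot (frenetT r s) (frenetN r s) = 0.
Proof.
intros HI Hsm Ha Hs Hr.
destruct (frenet_regularity I r s Hsm Hs Hr) as [RT _].
destruct (curvature_spec r s Hr) as [Kp HK].
assert (D := Derive_dot _ _ s RT RT).
rewrite (Derive_locally_const I _ 1 s HI Hs) in D
  by (intros y Hy; now apply (frenetTT I)).
rewrite HK, dot_scal_l, dot_scal_r, (dot_comm (frenetN r s)) in D.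
apply (Rmult_eq_reg_l (curvature r s)); lra.
Qed.

Lemma orthonormal_expand (a n v : R3) :
  dot a a = 1 -> dot n n = 1 -> dot a n = 0 ->
  v = plus (plus (scal (dot v a) a) (scal (dot v n) n))
        (scal (dot v (cross a n)) (cross a n)).
Proof.
destruct a as [[a1 a2] a3], n as [[n1 n2] n3], v as [[v1 v2] v3].
unfold cross, dot, crd1, crd2, crd3; simpl.
rewrite !scal_R3, !plus_R3.
intros H1 H2 H3.
apply (f_equal2 pair); [apply (f_equal2 pair) |]; nsatz.
Qed.

Lemma frenet_serret (I : R -> Prop) (r : R -> R3) (s k tau : R) :
  is_open_interval I -> smooth_curve I r -> arclength_param I r ->
  (forall y, I y -> vDerive (vDerive r) y <> zero) -> I s ->
  (vDerive (frenetT r) s = scal k (frenetN r s) /\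
   vDerive (frenetN r) s
     = plus (scal (- k) (frenetT r s)) (scal tau (frenetB r s)) /\
   vDerive (frenetB r) s = scal (- tau) (frenetN r s))
  <-> k = curvature r s /\ tau = torsion r s.
Proof.
intros HI Hsm Ha Hr Hs.
destruct (frenet_regularity I r s Hsm Hs (Hr s Hs)) as [RT RN].
destruct (curvature_spec r s (Hr s Hs)) as [Kp HK].
assert (TT := frenetTT I r s Ha Hs).
assert (NN := frenetNN r s (Hr s Hs)).
assert (TN := frenetTN I r s HI Hsm Ha Hs (Hr s Hs)).
assert (DN := Derive_dot _ _ s RN RN).
rewrite (Derive_locally_const I _ 1 s HI Hs) in DN
  by (intros y Hy; now apply frenetNN, Hr).
assert (DTN := Derive_dot _ _ s RT RN).
rewrite (Derive_locally_const I _ 0 s HI Hs) in DTN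
  by (intros y Hy; apply (frenetTN I); auto).
assert (DB := vDerive_cross _ _ s RT RN).
change (fun y => cross (frenetT r y) (frenetN r y)) with (frenetB r) in DB.
assert (EX := orthonormal_expand _ _ (vDerive (frenetN r) s) TT NN TN).
fold (frenetB r s) in EX. fold (torsion r s) in EX.
rewrite HK in DB, DTN.
unfold torsion in *.
assert (EB : frenetB r s = cross (frenetT r s) (frenetN r s)) by reflexivity.
revert HK EX DB.
rewrite EB; clear EB.
generalize (vDerive (frenetB r) s) as dB.
generalize (vDerive (frenetT r) s) as dT.
revert DTN DN TN NN TT.
generalize (vDerive (frenetN r) s) as dN.
generalize (frenetT r s) as T. generalize (frenetN r s) as N.
revert Kp. generalize (curvature r s) as K.
intros K Kp [[n1 n2] n3] [[a1 a2] a3] [[m1 m2] m3] DTN DN TN NN TT dT dB HK EX DB.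
subst dT dB.
set (q := dot (m1, m2, m3) (cross (a1, a2, a3) (n1, n2, n3))) in *.
assert (E1 : dot (m1, m2, m3) (a1, a2, a3) = - K).
{ rewrite dot_scal_l, NN, (dot_comm (a1, a2, a3)) in DTN; lra. }
assert (E2 : dot (m1, m2, m3) (n1, n2, n3) = 0).
{ rewrite (dot_comm (n1, n2, n3)) in DN; lra. }
rewrite E1, E2 in EX.
clearbody q.
unfold dot, cross, crd1, crd2, crd3 in *; simpl in *.
rewrite !scal_R3, ?plus_R3 in *.
injection EX as M1 M2 M3.
clear DTN DN E1 E2.
split.
- intros [A1 [A2 _]].
  injection A1 as P1 P2 P3. injection A2 as Q1 Q2 Q3.
  assert (HkK : k = K) by (clear - P1 P2 P3 NN; nsatz).
  split; [exact HkK |]. subst k.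
  clear P1 P2 P3 Kp.
  nsatz.
- intros [-> ->]. split; [reflexivity |].
  split.
  + apply (f_equal2 pair); [apply (f_equal2 pair) |]; clear - M1 M2 M3; lra.
  + clear Kp; apply (f_equal2 pair); [apply (f_equal2 pair) |]; nsatz.
Qed.

(* Main.v *)
(** By the Frenet equations the frame components of x_s are 1 + u_s - kappa v,
v_s + kappa u - tau w and w_s + tau v, and those of x_t are u_t, v_t and w_t.
Hence the first two equations say that x is isothermal, and the last three that its
Laplacian x_ss + x_tt vanishes. Differentiating the isothermal relations shows that
the Laplacian is normal to the surface, and its normal component is the mean
curvature times 2 <x_s, x_s>; so an isothermal surface is minimal iff it is harmonic.
For the direct implication, u, v, w are the frame components of x - r, which are
smooth because the frame is. *)

Require Import Defs.
From Stdlib Require Import Reals Lra Lia.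
From Coquelicot Require Import Coquelicot.

Open Scope R_scope.

(** * Local reasoning on open intervals and rectangles *)

Lemma locally_2d_rectangle (I J : R -> Prop) (s t : R) (P : R -> R -> Prop) :
  is_open_interval I -> is_open_interval J -> I s -> J t ->
  (forall s' t', I s' -> J t' -> P s' t') -> locally_2d P s t.
Proof.
intros HI HJ Hs Ht HP.
destruct (is_open_interval_locally I s HI Hs) as [d1 H1].
destruct (is_open_interval_locally J t HJ Ht) as [d2 H2].
assert (Hd : 0 < Rmin d1 d2) by (apply Rmin_case; apply cond_pos).
exists (mkposreal _ Hd); simpl; intros u v Hu Hv.
apply HP; [apply H1 | apply H2].
- apply Rlt_le_trans with (1 := Hu), Rmin_l.
- apply Rlt_le_trans with (1 := Hv), Rmin_r.
Qed.

Lemma Derive_ext_on (I : R -> Prop) (f g : R -> R) (s : R) :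
  is_open_interval I -> I s -> (forall y, I y -> f y = g y) ->
  Derive f s = Derive g s.
Proof.
intros HI Hs H.
apply Derive_ext_loc.
apply (filter_imp I); [exact H | now apply is_open_interval_locally].
Qed.

Lemma vDerive_ext_on (I : R -> Prop) (f g : R -> R3) (s : R) :
  is_open_interval I -> I s -> (forall y, I y -> f y = g y) ->
  vDerive f s = vDerive g s.
Proof.
intros HI Hs H; unfold vDerive.
apply (f_equal2 pair); [apply (f_equal2 pair) |];
  apply (Derive_ext_on I); auto; intros y Hy; now rewrite H.
Qed.

(** * Functions with continuous partial derivatives up to a fixed order *)

Definition ck2_on (I J : R -> Prop) (n : nat) (f : R -> R -> R) : Prop :=
  forall s t : R, I s -> J t -> ex_diff_n f n s t.

(** Induction step of the closure lemmas below: it replaces the [Derive] terms inside [ex_diff_n] by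
    explicit formulas [f1] and [f2]. These agree with the partial derivatives on the whole open
    rectangle, hence near each of its points, and [ex_diff_n] is a local property. *)
Lemma ck2_on_S (I J : R -> Prop) (n : nat) (f f1 f2 : R -> R -> R) :
  is_open_interval I -> is_open_interval J ->
  (forall s t, I s -> J t ->
     continuity_2d_pt f s t /\
     is_derive (fun s' => f s' t) s (f1 s t) /\
     is_derive (fun t' => f s t') t (f2 s t)) ->
  ck2_on I J n f1 -> ck2_on I J n f2 -> ck2_on I J (S n) f.
Proof.
intros HI HJ H H1 H2 s t Hs Ht.
destruct (H s t Hs Ht) as [C [D1 D2]].
split; [exact C |].
split; [now exists (f1 s t) |].
split; [now exists (f2 s t) |].
split.
- apply (ex_diff_n_ext_loc f1); [| now apply H1].
  apply (locally_2d_rectangle I J); auto.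
  intros s' t' Hs' Ht'; symmetry.
  now apply is_derive_unique, H.
- apply (ex_diff_n_ext_loc f2); [| now apply H2].
  apply (locally_2d_rectangle I J); auto.
  intros s' t' Hs' Ht'; symmetry.
  now apply is_derive_unique, H.
Qed.

Lemma ck2_on_continuity (I J : R -> Prop) (n : nat) (f : R -> R -> R) (s t : R) :
  ck2_on I J n f -> I s -> J t -> continuity_2d_pt f s t.
Proof.
intros H Hs Ht; specialize (H s t Hs Ht).
destruct n; exact (proj1 H).
Qed.

Lemma ck2_on_derive (I J : R -> Prop) (n : nat) (f : R -> R -> R) (s t : R) :
  ck2_on I J (S n) f -> I s -> J t ->
  is_derive (fun s' => f s' t) s (ds f s t) /\
  is_derive (fun t' => f s t') t (dt f s t).
Proof.
intros H Hs Ht.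
destruct (H s t Hs Ht) as [_ [D1 [D2 _]]].
split; now apply Derive_correct.
Qed.

Lemma ck2_on_ds (I J : R -> Prop) (n : nat) (f : R -> R -> R) :
  ck2_on I J (S n) f -> ck2_on I J n (ds f).
Proof. intros H s t Hs Ht; apply (H s t Hs Ht). Qed.

Lemma ck2_on_dt (I J : R -> Prop) (n : nat) (f : R -> R -> R) :
  ck2_on I J (S n) f -> ck2_on I J n (dt f).
Proof. intros H s t Hs Ht; apply (H s t Hs Ht). Qed.

Lemma ck2_on_le (I J : R -> Prop) (n : nat) (f : R -> R -> R) :
  ck2_on I J (S n) f -> ck2_on I J n f.
Proof. intros H s t Hs Ht; apply (ex_diff_n_m (S n)); [lia | now apply H]. Qed.

Lemma ck2_on_const (I J : R -> Prop) (n : nat) (c : R) :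
  is_open_interval I -> is_open_interval J -> ck2_on I J n (fun _ _ => c).
Proof.
intros HI HJ; revert c; induction n as [| n IH]; intros c.
- intros s t _ _; split; [apply continuity_2d_pt_const | exact Logic.I].
- apply (ck2_on_S I J n _ (fun _ _ => 0) (fun _ _ => 0)); auto.
  intros s t _ _; split; [apply continuity_2d_pt_const | split];
    apply is_derive_Reals, derivable_pt_lim_const.
Qed.

Lemma ck2_on_plus (I J : R -> Prop) (n : nat) (f g : R -> R -> R) :
  is_open_interval I -> is_open_interval J ->
  ck2_on I J n f -> ck2_on I J n g -> ck2_on I J n (fun s t => f s t + g s t).
Proof.
intros HI HJ; revert f g; induction n as [| n IH]; intros f g Hf Hg.
- intros s t Hs Ht; split; [| exact Logic.I].
  apply continuity_2d_pt_plus; now apply (ck2_on_continuity I J 0).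
- apply (ck2_on_S I J n _ (fun s t => ds f s t + ds g s t)
           (fun s t => dt f s t + dt g s t)); auto using ck2_on_ds, ck2_on_dt.
  intros s t Hs Ht.
  destruct (ck2_on_derive I J n f s t Hf Hs Ht) as [F1 F2].
  destruct (ck2_on_derive I J n g s t Hg Hs Ht) as [G1 G2].
  split; [apply continuity_2d_pt_plus; now apply (ck2_on_continuity I J (S n)) |].
  split; now apply (is_derive_plus (V := R_NormedModule)).
Qed.

Lemma ck2_on_mult (I J : R -> Prop) (n : nat) (f g : R -> R -> R) :
  is_open_interval I -> is_open_interval J ->
  ck2_on I J n f -> ck2_on I J n g -> ck2_on I J n (fun s t => f s t * g s t).
Proof.
intros HI HJ; revert f g; induction n as [| n IH]; intros f g Hf Hg.
- intros s t Hs Ht; split; [| exact Logic.I].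
  apply continuity_2d_pt_mult; now apply (ck2_on_continuity I J 0).
(* The product rule mixes derivatives, known to order [n], with [f] and [g] themselves, known to
   order [S n]; [ck2_on_le] lowers the latter so that the induction hypothesis applies to each
   product. *)
- apply (ck2_on_S I J n _ (fun s t => ds f s t * g s t + f s t * ds g s t)
           (fun s t => dt f s t * g s t + f s t * dt g s t));
    auto using ck2_on_ds, ck2_on_dt, ck2_on_plus, ck2_on_le.
  intros s t Hs Ht.
  destruct (ck2_on_derive I J n f s t Hf Hs Ht) as [F1 F2].
  destruct (ck2_on_derive I J n g s t Hg Hs Ht) as [G1 G2].
  split; [apply continuity_2d_pt_mult; now apply (ck2_on_continuity I J (S n)) |].
  split.
  + apply (is_derive_mult (fun s' => f s' t) (fun s' => g s' t)); auto using Rmult_comm.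
  + apply (is_derive_mult (fun t' => f s t') (fun t' => g s t')); auto using Rmult_comm.
Qed.

(* With h = d^(-1/2) the derivative of h is - d' h^3 / 2, again a polynomial in h
   and a smooth function; this closes the induction on the order. *)
Lemma ck2_on_inv_sqrt (I J : R -> Prop) (n : nat) (f : R -> R -> R) :
  is_open_interval I -> is_open_interval J ->
  (forall s t, I s -> J t -> 0 < f s t) ->
  ck2_on I J n f -> ck2_on I J n (fun s t => / sqrt (f s t)).
Proof.
intros HI HJ Hpos; induction n as [| n IH]; intros Hf.
(* Continuity is needed in both cases of the induction; it comes from composing the one-variable
   function with [f], away from the singularity at 0. *)
all: assert (C : forall s t, I s -> J t ->
         continuity_2d_pt (fun s t => / sqrt (f s t)) s t).
1, 3: intros s t Hs Ht; apply (continuity_1d_2d_pt_comp (fun y => / sqrt y));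
  [| exact (ck2_on_continuity I J _ f s t Hf Hs Ht)];
  apply continuity_pt_filterlim, (ex_derive_continuous (fun y => / sqrt y));
  specialize (Hpos s t Hs Ht);
  auto_derive; repeat split; [exact Hpos | now apply Rgt_not_eq, sqrt_lt_R0].
- intros s t Hs Ht; split; [now apply C | exact Logic.I].
- set (h := fun s t => / sqrt (f s t)).
  assert (Hh : ck2_on I J n h) by now apply IH, ck2_on_le.
  assert (D : forall (g : R -> R) y g', is_derive g y g' -> 0 < g y ->
      is_derive (fun z => / sqrt (g z)) y
        (- / 2 * g' * (/ sqrt (g y) * (/ sqrt (g y) * / sqrt (g y))))).
  { intros g y g' Hg Hy.
    assert (Q := sqrt_lt_R0 _ Hy).
    replace (- / 2 * g' * (/ sqrt (g y) * (/ sqrt (g y) * / sqrt (g y))))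
      with (- (g' / (2 * sqrt (g y))) / sqrt (g y) ^ 2) by (field; lra).
    apply (is_derive_inv (fun z => sqrt (g z))); [now apply is_derive_sqrt | lra]. }
  apply (ck2_on_S I J n _
           (fun s t => - / 2 * ds f s t * (h s t * (h s t * h s t)))
           (fun s t => - / 2 * dt f s t * (h s t * (h s t * h s t)))); auto.
  + intros s t Hs Ht.
    destruct (ck2_on_derive I J n f s t Hf Hs Ht) as [F1 F2].
    split; [now apply C |]; split.
    * apply (D (fun s' => f s' t)); auto.
    * apply (D (fun t' => f s t')); auto.
  + repeat apply ck2_on_mult; auto using ck2_on_const, ck2_on_ds.
  + repeat apply ck2_on_mult; auto using ck2_on_const, ck2_on_dt.
Qed.

Lemma smooth_on_Derive (I : R -> Prop) (f : R -> R) :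
  smooth_on I f -> smooth_on I (Derive f).
Proof.
intros Hf [| n] s Hs; [exact Logic.I |].
(* The derivative of order [n] of [Derive f] is the derivative of order [S n] of [f], so its
   differentiability is the assumption on [f] at order [S (S n)]. *)
apply (ex_derive_ext (Derive_n f (S n))).
- intros y; change (Derive f) with (Derive_n f 1).
  rewrite Derive_n_comp; f_equal; lia.
- exact (Hf (S (S n)) s Hs).
Qed.

(** The partial derivatives are [Derive f] and 0, and [Derive f] is again smooth, so the induction
    runs over all [f] at once. This allows the curve, its frame, curvature and torsion to be handled
    as functions of [(s, t)] constant in [t], with a single calculus for everything. *)
Lemma ck2_on_curve (I J : R -> Prop) (n : nat) (f : R -> R) :
  is_open_interval I -> is_open_interval J ->
  smooth_on I f -> ck2_on I J n (fun s _ => f s).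
Proof.
intros HI HJ; revert f; induction n as [| n IH]; intros f Hf.
all: assert (C : forall s t, I s -> J t -> continuity_2d_pt (fun s _ => f s) s t).
1, 3: intros s t Hs _; apply (continuity_1d_2d_pt_comp f (fun s _ => s));
  [ apply continuity_pt_filterlim, (ex_derive_continuous f), (Hf 1%nat s Hs)
  | apply continuity_2d_pt_id1 ].
- intros s t Hs Ht; split; [now apply C | exact Logic.I].
- apply (ck2_on_S I J n _ (fun s _ => Derive f s) (fun _ _ => 0));
    auto using ck2_on_const, smooth_on_Derive.
  intros s t Hs Ht; split; [now apply C | split].
  + apply Derive_correct, (Hf 1%nat s Hs).
  + apply is_derive_Reals, derivable_pt_lim_const.
Qed.

(** * Smooth functions of two variables *)

Lemma smooth2_ds (I J : R -> Prop) (f : R -> R -> R) :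
  smooth2_on I J f -> smooth2_on I J (ds f).
Proof. intros H n; apply ck2_on_ds; exact (H (S n)). Qed.

Lemma smooth2_dt (I J : R -> Prop) (f : R -> R -> R) :
  smooth2_on I J f -> smooth2_on I J (dt f).
Proof. intros H n; apply ck2_on_dt; exact (H (S n)). Qed.

Lemma smooth2_ex_ds (I J : R -> Prop) (f : R -> R -> R) (s t : R) :
  smooth2_on I J f -> I s -> J t -> ex_derive (fun s' => f s' t) s.
Proof. intros H Hs Ht; apply (H 1%nat s t Hs Ht). Qed.

Lemma smooth2_ex_dt (I J : R -> Prop) (f : R -> R -> R) (s t : R) :
  smooth2_on I J f -> I s -> J t -> ex_derive (fun t' => f s t') t.
Proof. intros H Hs Ht; apply (H 1%nat s t Hs Ht). Qed.

Lemma smooth2_ds_dt (I J : R -> Prop) (f : R -> R -> R) (s t : R) :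
  is_open_interval I -> is_open_interval J ->
  smooth2_on I J f -> I s -> J t -> ds (dt f) s t = dt (ds f) s t.
Proof.
intros HI HJ H Hs Ht.
assert (H1 := smooth2_ds I J f H). assert (H2 := smooth2_dt I J f H).
apply (Schwarz f).
- apply (locally_2d_rectangle I J); auto.
  intros s' t' Hs' Ht'; repeat split.
  + now apply (smooth2_ex_ds I J f).
  + now apply (smooth2_ex_dt I J f).
  + now apply (smooth2_ex_ds I J (dt f)).
  + now apply (smooth2_ex_dt I J (ds f)).
- apply (ck2_on_continuity I J 0 (ds (dt f))); auto.
  intros s' t'; now apply smooth2_ds.
- apply (ck2_on_continuity I J 0 (dt (ds f))); auto.
  intros s' t'; now apply smooth2_dt.
Qed.

Lemma smooth2_plus (I J : R -> Prop) (f g : R -> R -> R) :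
  is_open_interval I -> is_open_interval J ->
  smooth2_on I J f -> smooth2_on I J g ->
  smooth2_on I J (fun s t => f s t + g s t).
Proof. intros HI HJ Hf Hg n; exact (ck2_on_plus I J n f g HI HJ (Hf n) (Hg n)). Qed.

Lemma smooth2_mult (I J : R -> Prop) (f g : R -> R -> R) :
  is_open_interval I -> is_open_interval J ->
  smooth2_on I J f -> smooth2_on I J g ->
  smooth2_on I J (fun s t => f s t * g s t).
Proof. intros HI HJ Hf Hg n; exact (ck2_on_mult I J n f g HI HJ (Hf n) (Hg n)). Qed.

Lemma smooth2_const (I J : R -> Prop) (c : R) :
  is_open_interval I -> is_open_interval J -> smooth2_on I J (fun _ _ => c).
Proof. intros HI HJ n; now apply ck2_on_const. Qed.

Lemma smooth2_ext (I J : R -> Prop) (f g : R -> R -> R) :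
  is_open_interval I -> is_open_interval J ->
  (forall s t, I s -> J t -> f s t = g s t) ->
  smooth2_on I J f -> smooth2_on I J g.
Proof.
intros HI HJ H Hf n s t Hs Ht.
apply (ex_diff_n_ext_loc f); [now apply (locally_2d_rectangle I J) | now apply Hf].
Qed.

Lemma smooth2_minus (I J : R -> Prop) (f g : R -> R -> R) :
  is_open_interval I -> is_open_interval J ->
  smooth2_on I J f -> smooth2_on I J g ->
  smooth2_on I J (fun s t => f s t - g s t).
Proof.
intros HI HJ Hf Hg.
apply (smooth2_ext I J (fun s t => f s t + -1 * g s t)); auto.
- intros; ring.
- auto using smooth2_plus, smooth2_mult, smooth2_const.
Qed.

(** * Smooth vector-valued maps *)

Lemma smooth_surface_curve (I J : R -> Prop) (r : R -> R3) :
  is_open_interval I -> is_open_interval J ->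
  smooth_curve I r -> smooth_surface I J (fun s _ => r s).
Proof.
intros HI HJ [H1 [H2 H3]].
split; [| split]; intros n;
  apply (ck2_on_curve I J n (fun s => _ (r s))); assumption.
Qed.

Lemma smooth_surface_vds (I J : R -> Prop) (x : R -> R -> R3) :
  smooth_surface I J x -> smooth_surface I J (vds x).
Proof. intros [H1 [H2 H3]]; split; [| split]; now apply smooth2_ds. Qed.

Lemma smooth_surface_vdt (I J : R -> Prop) (x : R -> R -> R3) :
  smooth_surface I J x -> smooth_surface I J (vdt x).
Proof. intros [H1 [H2 H3]]; split; [| split]; now apply smooth2_dt. Qed.

Lemma smooth2_dot (I J : R -> Prop) (x y : R -> R -> R3) :
  is_open_interval I -> is_open_interval J ->
  smooth_surface I J x -> smooth_surface I J y ->
  smooth2_on I J (fun s t => dot (x s t) (y s t)).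
Proof.
intros HI HJ [X1 [X2 X3]] [Y1 [Y2 Y3]]; unfold dot.
auto 10 using smooth2_plus, smooth2_mult.
Qed.

Lemma smooth_surface_scal (I J : R -> Prop) (f : R -> R -> R) (x : R -> R -> R3) :
  is_open_interval I -> is_open_interval J ->
  smooth2_on I J f -> smooth_surface I J x ->
  smooth_surface I J (fun s t => scal (f s t) (x s t)).
Proof.
intros HI HJ F [X1 [X2 X3]].
split; [| split]; now apply smooth2_mult.
Qed.

Lemma smooth_surface_cross (I J : R -> Prop) (x y : R -> R -> R3) :
  is_open_interval I -> is_open_interval J ->
  smooth_surface I J x -> smooth_surface I J y ->
  smooth_surface I J (fun s t => cross (x s t) (y s t)).
Proof.
intros HI HJ [X1 [X2 X3]] [Y1 [Y2 Y3]].
split; [| split]; apply smooth2_minus; auto using smooth2_mult.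
Qed.

Lemma smooth_surface_ex_vds (I J : R -> Prop) (x : R -> R -> R3) (s t : R) :
  smooth_surface I J x -> I s -> J t -> ex_vderive (fun s' => x s' t) s.
Proof.
intros [X1 [X2 X3]] Hs Ht.
exact (conj (smooth2_ex_ds I J _ s t X1 Hs Ht)
         (conj (smooth2_ex_ds I J _ s t X2 Hs Ht) (smooth2_ex_ds I J _ s t X3 Hs Ht))).
Qed.

Lemma smooth_surface_ex_vdt (I J : R -> Prop) (x : R -> R -> R3) (s t : R) :
  smooth_surface I J x -> I s -> J t -> ex_vderive (fun t' => x s t') t.
Proof.
intros [X1 [X2 X3]] Hs Ht.
exact (conj (smooth2_ex_dt I J _ s t X1 Hs Ht)
         (conj (smooth2_ex_dt I J _ s t X2 Hs Ht) (smooth2_ex_dt I J _ s t X3 Hs Ht))).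
Qed.

Lemma smooth_surface_vds_vdt (I J : R -> Prop) (x : R -> R -> R3) (s t : R) :
  is_open_interval I -> is_open_interval J ->
  smooth_surface I J x -> I s -> J t -> vds (vdt x) s t = vdt (vds x) s t.
Proof.
intros HI HJ [X1 [X2 X3]] Hs Ht.
apply (f_equal2 pair); [apply (f_equal2 pair) |];
  now apply (smooth2_ds_dt I J (fun s t => _ (x s t))).
Qed.

(** * Linear algebra in three dimensions *)

Lemma R3_ext (a b : R3) :
  crd1 a = crd1 b -> crd2 a = crd2 b -> crd3 a = crd3 b -> a = b.
Proof.
destruct a as [[a1 a2] a3], b as [[b1 b2] b3].
unfold crd1, crd2, crd3; simpl; now intros -> -> ->.
Qed.

(* The implicit arguments are matched explicitly because the same operation occurs
   through several convertible algebraic structures on [R3]. *)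
Ltac R3_linear :=
  apply R3_ext;
  repeat match goal with
    | |- context [crd1 (@plus ?G ?a ?b)] =>
        change (crd1 (@plus G a b)) with (crd1 a + crd1 b)
    | |- context [crd2 (@plus ?G ?a ?b)] =>
        change (crd2 (@plus G a b)) with (crd2 a + crd2 b)
    | |- context [crd3 (@plus ?G ?a ?b)] =>
        change (crd3 (@plus G a b)) with (crd3 a + crd3 b)
    | |- context [crd1 (@scal ?K ?V ?k ?a)] =>
        change (crd1 (@scal K V k a)) with (k * crd1 a)
    | |- context [crd2 (@scal ?K ?V ?k ?a)] =>
        change (crd2 (@scal K V k a)) with (k * crd2 a)
    | |- context [crd3 (@scal ?K ?V ?k ?a)] =>
        change (crd3 (@scal K V k a)) with (k * crd3 a)
    | |- context [crd1 (@zero ?G)] => change (crd1 (@zero G)) with 0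
    | |- context [crd2 (@zero ?G)] => change (crd2 (@zero G)) with 0
    | |- context [crd3 (@zero ?G)] => change (crd3 (@zero G)) with 0
    end; ring.

Lemma dot_plus_l (a b c : R3) : dot (plus a b) c = dot a c + dot b c.
Proof.
destruct a as [[a1 a2] a3], b as [[b1 b2] b3]; rewrite plus_R3.
unfold dot, crd1, crd2, crd3; simpl; ring.
Qed.

Lemma dot_zero_l (a : R3) : dot zero a = 0.
Proof. unfold dot, crd1, crd2, crd3, zero; simpl; unfold zero; simpl; ring. Qed.

Lemma R3_eq_dec (a b : R3) : {a = b} + {a <> b}.
Proof.
destruct a as [[a1 a2] a3], b as [[b1 b2] b3].
destruct (Req_dec_T a1 b1) as [-> |]; [| right; congruence].
destruct (Req_dec_T a2 b2) as [-> |]; [| right; congruence].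
destruct (Req_dec_T a3 b3) as [-> |]; [left; reflexivity | right; congruence].
Qed.

Lemma dot_self_eq_0 (a : R3) : dot a a = 0 -> a = zero.
Proof.
intros H; destruct (R3_eq_dec a zero) as [E | E]; [exact E |].
apply dot_pos in E; lra.
Qed.

Lemma Lagrange_identity (a b : R3) :
  dot (cross a b) (cross a b) = dot a a * dot b b - dot a b ^ 2.
Proof. unfold dot, cross, crd1, crd2, crd3; simpl; ring. Qed.

(** The triple product expansion [v x (a x b) = <v,b> a - <v,a> b] vanishes, so the Lagrange
    identity for [v] and [a x b] reduces to [|v|^2 |a x b|^2 = 0]. *)
Lemma orthogonal_to_basis (v a b : R3) :
  cross a b <> zero -> dot v a = 0 -> dot v b = 0 -> dot v (cross a b) = 0 ->
  v = zero.
Proof.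
intros Hc Ha Hb Hn.
apply dot_self_eq_0.
apply dot_pos in Hc.
apply (Rmult_eq_reg_r (dot (cross a b) (cross a b))); [| lra].
assert (Hv : cross v (cross a b) = plus (scal (dot v b) a) (scal (- dot v a) b)).
{ destruct a as [[a1 a2] a3], b as [[b1 b2] b3], v as [[v1 v2] v3].
  rewrite !scal_R3, plus_R3; unfold cross, dot, crd1, crd2, crd3; simpl.
  apply (f_equal2 pair); [apply (f_equal2 pair) |]; ring. }
assert (L := Lagrange_identity v (cross a b)).
rewrite Hv, Hn, Ha, Hb, dot_plus_l, !dot_scal_l in L.
lra.
Qed.

(** * Isothermal surfaces: minimality and harmonicity *)

Definition laplacian (x : R -> R -> R3) (s t : R) : R3 :=
  plus (vds (vds x) s t) (vdt (vdt x) s t).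

(** With E, F, G the coefficients of the first fundamental form, [E_s = G_s] gives
    [<x_ss,x_s> = <x_st,x_t>], and [F_t = 0] gives [<x_st,x_t> + <x_s,x_tt> = 0]; together they
    yield the first claim. The second follows in the same way from [E_t = G_t] and [F_s = 0]. *)
Lemma isothermal_laplacian_orthogonal
  (I J : R -> Prop) (x : R -> R -> R3) (s t : R) :
  is_open_interval I -> is_open_interval J -> smooth_surface I J x ->
  isothermal I J x -> I s -> J t ->
  dot (laplacian x s t) (vds x s t) = 0 /\ dot (laplacian x s t) (vdt x s t) = 0.
Proof.
intros HI HJ Hx Hiso Hs Ht.
assert (X1 := smooth_surface_vds I J x Hx).
assert (X2 := smooth_surface_vdt I J x Hx).
assert (P1 := smooth_surface_ex_vds I J _ s t X1 Hs Ht).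
assert (P2 := smooth_surface_ex_vdt I J _ s t X1 Hs Ht).
assert (Q1 := smooth_surface_ex_vds I J _ s t X2 Hs Ht).
assert (Q2 := smooth_surface_ex_vdt I J _ s t X2 Hs Ht).
assert (Es := Derive_dot _ _ s P1 P1). assert (Et := Derive_dot _ _ t P2 P2).
assert (Gs := Derive_dot _ _ s Q1 Q1). assert (Gt := Derive_dot _ _ t Q2 Q2).
assert (Fs := Derive_dot _ _ s P1 Q1). assert (Ft := Derive_dot _ _ t P2 Q2).
assert (Ds : Derive (fun s' => dot (vds x s' t) (vds x s' t)) s
           = Derive (fun s' => dot (vdt x s' t) (vdt x s' t)) s)
  by (apply (Derive_ext_on I); auto; intros; now apply Hiso).
assert (Dt : Derive (fun t' => dot (vds x s t') (vds x s t')) t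
           = Derive (fun t' => dot (vdt x s t') (vdt x s t')) t)
  by (apply (Derive_ext_on J); auto; intros; now apply Hiso).
rewrite (Derive_locally_const I _ 0) in Fs by (auto; intros; now apply Hiso).
rewrite (Derive_locally_const J _ 0) in Ft by (auto; intros; now apply Hiso).
assert (EGs := eq_trans (eq_sym Es) (eq_trans Ds Gs)).
assert (EGt := eq_trans (eq_sym Et) (eq_trans Dt Gt)).
clear Ds Dt Es Et Gs Gt P1 P2 Q1 Q2.
change (vDerive (fun y => vds x y t) s) with (vds (vds x) s t) in *.
change (vDerive (fun y => vdt x y t) s) with (vds (vdt x) s t) in *.
change (vDerive (fun y => vds x s y) t) with (vdt (vds x) s t) in *.
change (vDerive (fun y => vdt x s y) t) with (vdt (vdt x) s t) in *.
(* By symmetry of the mixed partials, the four differentiated relations involve the same products,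
   and the claim is linear in them. *)
rewrite (smooth_surface_vds_vdt I J) in * by auto.
unfold laplacian; rewrite !dot_plus_l.
unfold dot in *; lra.
Qed.

(** With E = G and F = 0 the mean curvature is [(e + g) / (2 G)], where [e + g] is the component of
    the Laplacian along the unit normal. As the tangential components vanish already, regularity
    turns a zero normal component into a zero Laplacian. *)
Lemma isothermal_minimal_iff_harmonic
  (I J : R -> Prop) (x : R -> R -> R3) :
  is_open_interval I -> is_open_interval J ->
  smooth_surface I J x -> regular I J x -> isothermal I J x ->
  (minimal I J x <-> forall s t, I s -> J t -> laplacian x s t = zero).
Proof.
intros HI HJ Hx Hreg Hiso.
split; intros H s t Hs Ht.
- destruct (isothermal_laplacian_orthogonal I J x s t) as [L1 L2]; auto.
  apply (orthogonal_to_basis _ (vds x s t) (vdt x s t)); auto.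
  specialize (H s t Hs Ht).
  assert (C := dot_pos _ (Hreg s t Hs Ht)).
  assert (Q := sqrt_lt_R0 _ C).
  destruct (Hiso s t Hs Ht) as [HE HF].
  rewrite Lagrange_identity in C.
  revert H; unfold mean_curvature, unit_normal; cbv zeta.
  unfold laplacian; rewrite dot_plus_l, !dot_scal_r.
  unfold vnorm.
  rewrite HF in *. rewrite HE in *.
  set (k := sqrt _) in *. set (g := dot (vdt x s t) (vdt x s t)) in *.
  set (e1 := dot (vds (vds x) s t) _). set (g1 := dot (vdt (vdt x) s t) _).
  intros H.
  (* By the Lagrange identity, [|x_s x x_t|^2 = g^2] here, and regularity makes it positive. *)
  assert (Hg : g <> 0) by (intros Z; rewrite Z in C; lra).
  (* [e1] and [g1] are taken against the unnormalized normal, of length [k]; hence their sum is the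
     mean curvature times [2 * k * g]. *)
  replace (e1 + g1) with (((/ k * e1 * g - 2 * (/ k * dot (vds (vdt x) s t) (cross (vds x s t) (vdt x s t))) * 0
     + / k * g1 * g) / (2 * (g * g - 0 ^ 2))) * (2 * k * g)) by (field; lra).
  rewrite H; ring.
- specialize (H s t Hs Ht).
  destruct (Hiso s t Hs Ht) as [HE HF].
  unfold mean_curvature; cbv zeta.
  rewrite HF, HE.
  assert (L := dot_plus_l (vds (vds x) s t) (vdt (vdt x) s t) (unit_normal x s t)).
  fold (laplacian x s t) in L; rewrite H, dot_zero_l in L.
  set (e1 := dot (vds (vds x) s t) _) in *.
  set (g1 := dot (vdt (vdt x) s t) _) in *.
  (* The numerator cancels, so the quotient is 0 whatever its denominator. *)
  replace g1 with (- e1) by lra.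
  unfold Rdiv; ring.
Qed.

(** * Differentiation rules for vector-valued functions *)

Lemma ex_vderive_scal (a : R -> R) (f : R -> R3) (s : R) :
  ex_derive a s -> ex_vderive f s -> ex_vderive (fun y => scal (a y) (f y)) s.
Proof.
intros A [F1 [F2 F3]].
exact (conj (ex_derive_mult _ _ s A F1)
         (conj (ex_derive_mult _ _ s A F2) (ex_derive_mult _ _ s A F3))).
Qed.

Lemma ex_vderive_plus (f g : R -> R3) (s : R) :
  ex_vderive f s -> ex_vderive g s -> ex_vderive (fun y => plus (f y) (g y)) s.
Proof.
intros [F1 [F2 F3]] [G1 [G2 G3]].
exact (conj (ex_derive_plus (V := R_NormedModule) _ _ s F1 G1)
         (conj (ex_derive_plus (V := R_NormedModule) _ _ s F2 G2)
            (ex_derive_plus (V := R_NormedModule) _ _ s F3 G3))).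
Qed.

Lemma vDerive_plus (f g : R -> R3) (s : R) :
  ex_vderive f s -> ex_vderive g s ->
  vDerive (fun y => plus (f y) (g y)) s = plus (vDerive f s) (vDerive g s).
Proof.
intros [F1 [F2 F3]] [G1 [G2 G3]].
exact (f_equal2 pair (f_equal2 pair (Derive_plus _ _ s F1 G1)
         (Derive_plus _ _ s F2 G2)) (Derive_plus _ _ s F3 G3)).
Qed.

Lemma vDerive_scal (a : R -> R) (f : R -> R3) (s : R) :
  ex_derive a s -> ex_vderive f s ->
  vDerive (fun y => scal (a y) (f y)) s
  = plus (scal (Derive a s) (f s)) (scal (a s) (vDerive f s)).
Proof.
intros A [F1 [F2 F3]].
exact (f_equal2 pair (f_equal2 pair (Derive_mult _ _ s A F1)
         (Derive_mult _ _ s A F2)) (Derive_mult _ _ s A F3)).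
Qed.

Lemma ex_vderive_const (c : R3) (s : R) : ex_vderive (fun _ => c) s.
Proof. repeat split; apply ex_derive_const. Qed.

Lemma vDerive_const (c : R3) (s : R) : vDerive (fun _ => c) s = zero.
Proof.
exact (f_equal2 pair (f_equal2 pair (Derive_const _ s) (Derive_const _ s))
         (Derive_const _ s)).
Qed.

(** * Calculus in Frenet frame components *)

Definition frame (r : R -> R3) (s a b c : R) : R3 :=
  plus (scal a (frenetT r s))
    (plus (scal b (frenetN r s)) (scal c (frenetB r s))).

Lemma plus_frame (r : R -> R3) (s a b c a' b' c' : R) :
  plus (frame r s a b c) (frame r s a' b' c')
  = frame r s (a + a') (b + b') (c + c').
Proof.
unfold frame.
R3_linear.
Qed.

Lemma frame_T (r : R -> R3) (s a b c : R) :
  plus (frenetT r s) (frame r s a b c) = frame r s (1 + a) b c.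
Proof.
unfold frame.
R3_linear.
Qed.

Lemma dot_frame (I : R -> Prop) (r : R -> R3) (s a b c a' b' c' : R) :
  is_open_interval I -> smooth_curve I r -> arclength_param I r -> I s ->
  vDerive (vDerive r) s <> zero ->
  dot (frame r s a b c) (frame r s a' b' c') = a * a' + b * b' + c * c'.
Proof.
intros HI Hr Ha Hs Hr2.
assert (TT := frenetTT I r s Ha Hs).
assert (NN := frenetNN r s Hr2).
assert (TN := frenetTN I r s HI Hr Ha Hs Hr2).
(* B is a unit vector: [|T x N|^2 = |T|^2 |N|^2 - <T,N>^2 = 1]. *)
assert (BB := Lagrange_identity (frenetT r s) (frenetN r s)).
rewrite TT, NN, TN in BB.
assert (TB : dot (frenetT r s) (cross (frenetT r s) (frenetN r s)) = 0)
  by (unfold dot, cross, crd1, crd2, crd3; simpl; ring).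
assert (NB : dot (frenetN r s) (cross (frenetT r s) (frenetN r s)) = 0)
  by (unfold dot, cross, crd1, crd2, crd3; simpl; ring).
unfold frame.
rewrite (dot_comm (plus _ _)), !dot_plus_l, !dot_scal_l.
rewrite !(dot_comm _ (plus _ _)), !dot_plus_l, !dot_scal_l.
unfold frenetB.
rewrite (dot_comm (frenetN r s) (frenetT r s)).
rewrite !(dot_comm (cross (frenetT r s) (frenetN r s)) (frenetT r s)).
rewrite !(dot_comm (cross (frenetT r s) (frenetN r s)) (frenetN r s)).
rewrite TT, NN, TN, TB, NB, BB; ring.
Qed.

(** Orthonormal expansion of [p - o]. Each coefficient is kept as a difference of two dot products,
    the form of the witnesses in [theorem1], whose smoothness is then immediate. *)
Lemma frame_expand (I : R -> Prop) (r : R -> R3) (s : R) (p o : R3) :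
  is_open_interval I -> smooth_curve I r -> arclength_param I r -> I s ->
  vDerive (vDerive r) s <> zero ->
  p = plus o (frame r s (dot p (frenetT r s) - dot o (frenetT r s))
                (dot p (frenetN r s) - dot o (frenetN r s))
                (dot p (frenetB r s) - dot o (frenetB r s))).
Proof.
intros HI Hr Ha Hs Hr2.
assert (E := orthonormal_expand (frenetT r s) (frenetN r s) (plus p (scal (-1) o))
               (frenetTT I r s Ha Hs) (frenetNN r s Hr2)
               (frenetTN I r s HI Hr Ha Hs Hr2)).
fold (frenetB r s) in E.
rewrite !dot_plus_l, !dot_scal_l in E.
refine (eq_trans _ (eq_trans (f_equal (plus o) E) _)); unfold frame; R3_linear.
Qed.

(** The squared length of the combination is [a^2 + b^2 + c^2]. This splits the vector equation for
    the Laplacian into three scalar ones. *)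
Lemma frame_eq_zero (I : R -> Prop) (r : R -> R3) (s a b c : R) :
  is_open_interval I -> smooth_curve I r -> arclength_param I r -> I s ->
  vDerive (vDerive r) s <> zero ->
  frame r s a b c = zero <-> a = 0 /\ b = 0 /\ c = 0.
Proof.
intros HI Hr Ha Hs Hr2.
assert (D := dot_frame I r s a b c a b c HI Hr Ha Hs Hr2).
split.
- intros E; rewrite E, dot_zero_l in D; nra.
- intros [-> [-> ->]]; apply dot_self_eq_0; rewrite D; ring.
Qed.

Lemma ex_vderive_cross (f g : R -> R3) (s : R) :
  ex_vderive f s -> ex_vderive g s -> ex_vderive (fun y => cross (f y) (g y)) s.
Proof.
intros [F1 [F2 F3]] [G1 [G2 G3]].
assert (M : forall p q p' q' : R -> R,
  ex_derive p s -> ex_derive q s -> ex_derive p' s -> ex_derive q' s ->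
  ex_derive (fun y => p y * q y - p' y * q' y) s).
{ intros p q p' q' Hp Hq Hp' Hq'.
  exact (ex_derive_minus (V := R_NormedModule) _ _ s (ex_derive_mult p q s Hp Hq)
           (ex_derive_mult p' q' s Hp' Hq')). }
exact (conj (M _ _ _ _ F2 G3 F3 G2)
         (conj (M _ _ _ _ F3 G1 F1 G3) (M _ _ _ _ F1 G2 F2 G1))).
Qed.

(** Product rule, with T', N' and B' replaced through the Frenet equations and the terms regrouped
    along the frame. *)
Lemma frame_vDerive (I : R -> Prop) (r : R -> R3) (s : R) (a b c : R -> R) :
  is_open_interval I -> smooth_curve I r -> arclength_param I r ->
  (forall y, I y -> vDerive (vDerive r) y <> zero) -> I s ->
  ex_derive a s -> ex_derive b s -> ex_derive c s ->
  ex_vderive (fun y => frame r y (a y) (b y) (c y)) s /\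
  vDerive (fun y => frame r y (a y) (b y) (c y)) s
  = frame r s (Derive a s - curvature r s * b s)
      (Derive b s + curvature r s * a s - torsion r s * c s)
      (Derive c s + torsion r s * b s).
Proof.
intros HI Hr Ha Hr2 Hs Da Db Dc.
destruct (frenet_regularity I r s Hr Hs (Hr2 s Hs)) as [ET EN].
assert (EB : ex_vderive (frenetB r) s)
  by exact (ex_vderive_cross _ _ s ET EN).
destruct (proj2 (frenet_serret I r s _ _ HI Hr Ha Hr2 Hs) (conj eq_refl eq_refl))
  as [DT [DN DB]].
assert (XT := ex_vderive_scal _ _ s Da ET).
assert (XN := ex_vderive_scal _ _ s Db EN).
assert (XB := ex_vderive_scal _ _ s Dc EB).
assert (XNB := ex_vderive_plus _ _ s XN XB).
split; [exact (ex_vderive_plus _ _ s XT XNB) |].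
refine (eq_trans (vDerive_plus _ _ s XT XNB) _).
refine (eq_trans (f_equal2 plus (vDerive_scal a _ s Da ET)
          (eq_trans (vDerive_plus _ _ s XN XB)
             (f_equal2 plus (vDerive_scal b _ s Db EN)
                (vDerive_scal c _ s Dc EB)))) _).
rewrite DT, DN, DB; unfold frame.
R3_linear.
Qed.

(** The counterpart in the direction of [t], along which the frame stays fixed. *)
Lemma frame_vDerive_coefficients (r : R -> R3) (s t : R) (a b c : R -> R) :
  ex_derive a t -> ex_derive b t -> ex_derive c t ->
  ex_vderive (fun y => frame r s (a y) (b y) (c y)) t /\
  vDerive (fun y => frame r s (a y) (b y) (c y)) t
  = frame r s (Derive a t) (Derive b t) (Derive c t).
Proof.
intros Da Db Dc.
assert (CT := ex_vderive_const (frenetT r s) t).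
assert (CN := ex_vderive_const (frenetN r s) t).
assert (CB := ex_vderive_const (frenetB r s) t).
assert (XT := ex_vderive_scal _ _ t Da CT).
assert (XN := ex_vderive_scal _ _ t Db CN).
assert (XB := ex_vderive_scal _ _ t Dc CB).
assert (XNB := ex_vderive_plus _ _ t XN XB).
split; [exact (ex_vderive_plus _ _ t XT XNB) |].
refine (eq_trans (vDerive_plus _ _ t XT XNB) _).
refine (eq_trans (f_equal2 plus (vDerive_scal a _ t Da CT)
          (eq_trans (vDerive_plus _ _ t XN XB)
             (f_equal2 plus (vDerive_scal b _ t Db CN)
                (vDerive_scal c _ t Dc CB)))) _).
unfold frame.
rewrite (vDerive_const (frenetT r s)), (vDerive_const (frenetN r s)),
  (vDerive_const (frenetB r s)).
R3_linear.
Qed.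

(** * Smoothness of the frame, the curvature and the torsion *)

Lemma smooth_frenet (I J : R -> Prop) (r : R -> R3) :
  is_open_interval I -> is_open_interval J -> smooth_curve I r ->
  (forall s, I s -> vDerive (vDerive r) s <> zero) ->
  smooth_surface I J (fun s _ => frenetT r s) /\
  smooth_surface I J (fun s _ => frenetN r s) /\
  smooth_surface I J (fun s _ => frenetB r s).
Proof.
intros HI HJ Hr Hr2.
assert (ST : smooth_surface I J (fun s _ => frenetT r s))
  by exact (smooth_surface_vds I J _ (smooth_surface_curve I J r HI HJ Hr)).
assert (ST' := smooth_surface_vds I J _ ST).
(* N is T' scaled by the inverse square root of [<T',T'>], which is positive because r'' does not
   vanish. *)
assert (SN : smooth_surface I J (fun s _ => frenetN r s)).
{ unfold frenetN, vnorm.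
  apply (smooth_surface_scal I J
           (fun s _ => / sqrt (dot (vDerive (frenetT r) s) (vDerive (frenetT r) s))));
    auto.
  intros n; apply (ck2_on_inv_sqrt I J n
           (fun s _ => dot (vDerive (frenetT r) s) (vDerive (frenetT r) s))); auto.
  - intros s _ Hs _; now apply dot_pos, Hr2.
  - intros s t; now apply (smooth2_dot I J (vds (fun s _ => frenetT r s))
                             (vds (fun s _ => frenetT r s))). }
split; [exact ST | split; [exact SN |]].
exact (smooth_surface_cross I J _ _ HI HJ ST SN).
Qed.

(** The curvature is defined through a square root, but on I it equals [<T',N>]; both functions are
    thus dot products of smooth vectors. *)
Lemma smooth_curvature_torsion (I J : R -> Prop) (r : R -> R3) :
  is_open_interval I -> is_open_interval J ->
  smooth_curve I r -> (forall s, I s -> vDerive (vDerive r) s <> zero) ->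
  smooth2_on I J (fun s _ => curvature r s) /\
  smooth2_on I J (fun s _ => torsion r s).
Proof.
intros HI HJ Hr Hr2.
destruct (smooth_frenet I J r HI HJ Hr Hr2) as [ST [SN SB]].
split.
- apply (smooth2_ext I J
           (fun s _ => dot (vDerive (frenetT r) s) (frenetN r s))); auto.
  + intros s _ Hs _.
    destruct (curvature_spec r s (Hr2 s Hs)) as [_ ->].
    rewrite dot_scal_l, frenetNN by auto; ring.
  + exact (smooth2_dot I J _ _ HI HJ (smooth_surface_vds I J _ ST) SN).
- exact (smooth2_dot I J _ _ HI HJ (smooth_surface_vds I J _ SN) SB).
Qed.

(** * Derivatives of the surface in frame components *)

Lemma frame_derivatives (I J : R -> Prop) (r : R -> R3) (x : R -> R -> R3)
  (u v w : R -> R -> R) :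
  is_open_interval I -> is_open_interval J ->
  smooth_curve I r -> arclength_param I r ->
  (forall s, I s -> vDerive (vDerive r) s <> zero) ->
  smooth2_on I J u -> smooth2_on I J v -> smooth2_on I J w ->
  (forall s t, I s -> J t ->
     x s t = plus (r s) (frame r s (u s t) (v s t) (w s t))) ->
  let p := fun s t => 1 + ds u s t - curvature r s * v s t in
  let q := fun s t => ds v s t + curvature r s * u s t - torsion r s * w s t in
  let m := fun s t => ds w s t + torsion r s * v s t in
  forall s t, I s -> J t ->
    vds x s t = frame r s (p s t) (q s t) (m s t) /\
    vdt x s t = frame r s (dt u s t) (dt v s t) (dt w s t) /\
    laplacian x s t
    = frame r s (ds p s t - curvature r s * q s t + dt (dt u) s t)
        (ds q s t + curvature r s * p s t - torsion r s * m s t + dt (dt v) s t)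
        (ds m s t + torsion r s * q s t + dt (dt w) s t).
Proof.
intros HI HJ Hr Ha Hr2 Hu Hv Hw Hx p q m.
destruct (smooth_curvature_torsion I J r HI HJ Hr Hr2) as [Sk St].
(* The components of x_s are themselves smooth, so [frame_vDerive] can be applied a second time to
   obtain x_ss. *)
assert (Sp : smooth2_on I J p) by
  (apply smooth2_minus; auto; [apply smooth2_plus | apply smooth2_mult];
   auto using smooth2_const, smooth2_ds).
assert (Sq : smooth2_on I J q) by
  (apply smooth2_minus; auto; [apply smooth2_plus |]; auto using smooth2_ds;
   apply smooth2_mult; auto).
assert (Sm : smooth2_on I J m) by
  (apply smooth2_plus; auto using smooth2_ds; apply smooth2_mult; auto).
assert (Er : forall s, I s -> ex_vderive r s)
  by (intros s Hs; destruct Hr as [R1 [R2 R3]];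
      exact (conj (R1 1%nat s Hs) (conj (R2 1%nat s Hs) (R3 1%nat s Hs)))).
assert (Xs : forall s t, I s -> J t ->
          vds x s t = frame r s (p s t) (q s t) (m s t)).
{ intros s t Hs Ht; unfold vds.
  rewrite (vDerive_ext_on I _ (fun y => plus (r y) (frame r y (u y t) (v y t) (w y t))))
    by auto.
  destruct (frame_vDerive I r s (fun y => u y t) (fun y => v y t) (fun y => w y t))
    as [EF DF]; eauto using smooth2_ex_ds.
  rewrite vDerive_plus, DF by auto.
  (* r' = T accounts for the 1 in the first component. *)
  fold (frenetT r s); rewrite frame_T.
  unfold p, q, m, ds; f_equal; ring. }
assert (Xt : forall s t, I s -> J t ->
          vdt x s t = frame r s (dt u s t) (dt v s t) (dt w s t)).
{ intros s t Hs Ht; unfold vdt.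
  rewrite (vDerive_ext_on J _ (fun y => plus (r s) (frame r s (u s y) (v s y) (w s y))))
    by auto.
  destruct (frame_vDerive_coefficients r s t (u s) (v s) (w s)
              (smooth2_ex_dt I J u s t Hu Hs Ht) (smooth2_ex_dt I J v s t Hv Hs Ht)
              (smooth2_ex_dt I J w s t Hw Hs Ht)) as [EF DF].
  rewrite vDerive_plus, DF, vDerive_const, plus_zero_l by auto using ex_vderive_const.
  reflexivity. }
intros s t Hs Ht; split; [auto | split; [auto |]].
change (laplacian x s t)
  with (plus (vDerive (fun y => vds x y t) s) (vDerive (fun y => vdt x s y) t)).
(* The formulas for x_s and x_t hold along entire coordinate lines, so they may be differentiated
   once more. *)
rewrite (vDerive_ext_on I (fun y => vds x y t) (fun y => frame r y (p y t) (q y t) (m y t))) by auto.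
rewrite (vDerive_ext_on J (fun y => vdt x s y)
           (fun y => frame r s (dt u s y) (dt v s y) (dt w s y))) by auto.
destruct (frame_vDerive I r s (fun y => p y t) (fun y => q y t) (fun y => m y t))
  as [_ ->]; eauto using smooth2_ex_ds.
destruct (frame_vDerive_coefficients r s t (dt u s) (dt v s) (dt w s)
            (smooth2_ex_dt I J _ s t (smooth2_dt I J u Hu) Hs Ht)
            (smooth2_ex_dt I J _ s t (smooth2_dt I J v Hv) Hs Ht)
            (smooth2_ex_dt I J _ s t (smooth2_dt I J w Hw) Hs Ht)) as [_ ->].
apply plus_frame.
Qed.

(** * Equivalence of the geometric conditions and the component equations *)

Theorem theorem1
  (I J : R -> Prop) (t0 : R) (r : R -> R3) (x : R -> R -> R3)
  (hI : is_open_interval I) (hJ : is_open_interval J) (ht0 : J t0)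
  (hr : smooth_curve I r) (harc : arclength_param I r)
  (hr2 : forall s : R, I s -> vDerive (vDerive r) s <> zero)
  (hx : smooth_surface I J x) (hreg : regular I J x) :
  let T := frenetT r in
  let N := frenetN r in
  let B := frenetB r in
  let kappa := curvature r in
  let tau := torsion r in
  (isothermal I J x /\ minimal I J x /\ (forall s : R, I s -> x s t0 = r s))
  <->
  (exists u v w : R -> R -> R,
     (smooth2_on I J u /\ smooth2_on I J v /\ smooth2_on I J w) /\
     (forall s t : R, I s -> J t ->
        x s t = plus (r s) (plus (scal (u s t) (T s))
                  (plus (scal (v s t) (N s)) (scal (w s t) (B s))))) /\
     (forall s : R, I s -> u s t0 = 0 /\ v s t0 = 0 /\ w s t0 = 0) /\
     (forall s t : R, I s -> J t ->
        (1 + ds u s t - kappa s * v s t) ^ 2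
          + (ds v s t + kappa s * u s t - tau s * w s t) ^ 2
          + (ds w s t + tau s * v s t) ^ 2
        = (dt u s t) ^ 2 + (dt v s t) ^ 2 + (dt w s t) ^ 2 /\
        (1 + ds u s t - kappa s * v s t) * dt u s t
          + (ds v s t + kappa s * u s t - tau s * w s t) * dt v s t
          + (ds w s t + tau s * v s t) * dt w s t = 0 /\
        ds (fun s' t' => 1 + ds u s' t' - kappa s' * v s' t') s t
          - kappa s * (ds v s t + kappa s * u s t - tau s * w s t)
          + dt (dt u) s t = 0 /\
        ds (fun s' t' => ds v s' t' + kappa s' * u s' t' - tau s' * w s' t') s t
          + kappa s * (1 + ds u s t - kappa s * v s t)
          - tau s * (ds w s t + tau s * v s t)
          + dt (dt v) s t = 0 /\
        ds (fun s' t' => ds w s' t' + tau s' * v s' t') s t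
          + tau s * (ds v s t + kappa s * u s t - tau s * w s t)
          + dt (dt w) s t = 0)).
Proof.
intros T N B kappa tau.
assert (Key := fun u v w => frame_derivatives I J r x u v w hI hJ hr harc hr2).
split.
- intros [Hiso [Hmin H0]].
  rewrite (isothermal_minimal_iff_harmonic I J x) in Hmin by auto.
  destruct (smooth_frenet I J r hI hJ hr hr2) as [ST [SN SB]].
  assert (Sr := smooth_surface_curve I J r hI hJ hr).
  assert (C : forall F : R -> R3, smooth_surface I J (fun s _ => F s) ->
    smooth2_on I J (fun s t => dot (x s t) (F s) - dot (r s) (F s))).
  { intros F HF.
    exact (smooth2_minus I J _ _ hI hJ (smooth2_dot I J _ _ hI hJ hx HF)
             (smooth2_dot I J _ _ hI hJ Sr HF)). }
  (* The frame components of [x - r]; at [t0] the two products in each of them cancel. *)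
  exists (fun s t => dot (x s t) (T s) - dot (r s) (T s)),
         (fun s t => dot (x s t) (N s) - dot (r s) (N s)),
         (fun s t => dot (x s t) (B s) - dot (r s) (B s)).
  assert (Su := C _ ST). assert (Sv := C _ SN). assert (Sw := C _ SB).
  assert (Hx := fun s t (Hs : I s) (_ : J t) =>
                  frame_expand I r s (x s t) (r s) hI hr harc Hs (hr2 s Hs)).
  split; [auto | split; [exact Hx | split]].
  + intros s Hs; rewrite H0 by auto; repeat split; ring.
  + intros s t Hs Ht.
    destruct (Key _ _ _ Su Sv Sw Hx s t Hs Ht) as [Ks [Kt Kl]].
    destruct (Hiso s t Hs Ht) as [HE HF].
    (* The frame components of the Laplacian are exactly the left-hand sides of the last three
       equations. *)
    rewrite (Hmin s t Hs Ht) in Kl. symmetry in Kl.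
    rewrite (frame_eq_zero I) in Kl by auto.
    rewrite Ks, Kt, !(dot_frame I) in HE by auto.
    rewrite Ks, Kt, !(dot_frame I) in HF by auto.
    (* [dot_frame] produces products [a * a], to which [Rsqr] unfolds, whereas the statement has
       squares written as powers. *)
    split; [rewrite <- !Rsqr_pow2; exact HE |].
    split; [exact HF | exact Kl].
- intros [u [v [w [[Su [Sv Sw]] [Hx [H0 Heq]]]]]].
  specialize (Key u v w Su Sv Sw Hx).
  assert (Hiso : isothermal I J x).
  { intros s t Hs Ht.
    destruct (Key s t Hs Ht) as [Ks [Kt _]].
    destruct (Heq s t Hs Ht) as [HE [HF _]].
    rewrite Ks, Kt, !(dot_frame I) by auto.
    split; [rewrite <- !Rsqr_pow2 in HE; exact HE | exact HF]. }
  split; [exact Hiso | split].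
  + apply (isothermal_minimal_iff_harmonic I J x); auto.
    intros s t Hs Ht.
    destruct (Key s t Hs Ht) as [_ [_ ->]].
    apply (frame_eq_zero I); auto.
    exact (proj2 (proj2 (Heq s t Hs Ht))).
  (* At [t0] the three components vanish, which leaves [r s]. *)
  + intros s Hs; rewrite Hx by auto.
    destruct (H0 s Hs) as [Hu [Hv Hw]].
    rewrite Hu, Hv, Hw; R3_linear.
Qed.
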